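(* The Jones polynomial is a quantum cocycle invariant from a Laurent enhanced Yang--Baxter operator (LEYBO). Moreover, let $D$ be a closed braid diagram of the knot $K$ on $n$ strings, with $m^+$ positive and $m^-$ negative crossings. Then $$(\hbar+\hbar^{-1})\,J(K)=\hbar^{m^+-m^--n}\,\Phi_{(\tilde R_{(N)},\tilde R^{-1}_{(N)})}(K)$$ for some $\tilde R_{(N)}$ and $\tilde R^{-1}_{(N)}$, where $J(K)$ is the Jones polynomial of $K$ with $t^{1/2}=\hbar$ and $\Phi_{(\tilde R_{(N)},\tilde R^{-1}_{(N)})}(K)$ is the quantum cocycle invariant from the LEYBO $(\tilde R_{(N)},\tilde R^{-1}_{(N)})$.
   Context: $\mathbb k$ is a unital ring, $V$ a $\mathbb k$-module; ''knot'' means knot or link. A pre-Yang--Baxter operator (pre-YBO) is a linear map $R:V\otimes V\to V\otimes V$, not necessarily invertible, with $(R\otimes\mathbb 1)(\mathbb 1\otimes R)(R\otimes\mathbb 1)=(\mathbb 1\otimes R)(R\otimes\mathbb 1)(\mathbb 1\otimes R)$; it is a Yang--Baxter operator (YBO) if it is also invertible. Laurent deformation of order $N$ ($N=\infty$ is allowed): let $\tilde R_{(n)}=\sum_{i=0}^n\hbar^i\phi_i$ on $\tilde V_{(n)}=\mathbb k[[\hbar]]/(\hbar^{n+1})\otimes V$ and $\tilde R^{-1}_{(n)}=\sum_{i=0}^n\hat\hbar^i\hat\phi_i$ on $\hat V_{(n)}=\mathbb k[[\hat\hbar]]/(\hat\hbar^{n+1})\otimes V$ be pre-YBOs for all $n=0,\dots,N$.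 Regard $\tilde V_{(N)}$ and $\hat V_{(N)}$ as submodules of $\mathcal V=\mathbb k[[\hbar,\hat\hbar]]/(\hbar\hat\hbar-1)$, so that $\hat\hbar=\hbar^{-1}$. If $\tilde R_{(N)}$ and $\tilde R^{-1}_{(N)}$ satisfy the Yang--Baxter equation in $\mathcal V$ (exactly, not only modulo $\hbar^{N+1}$, respectively $\hat\hbar^{N+1}$) and are inverse to each other in $\mathcal V$, then $(\tilde R_{(N)},\tilde R^{-1}_{(N)})$ is called a YBO obtained by Laurent deformation, of order $N$, of the pre-YBOs $(\phi_0,\hat\phi_0)$. Enhanced YBO: a quadruple $(R,\alpha,\beta,\mu)$ of a YBO $R$, invertible scalars $\alpha,\beta$ and a linear map $\mu$ with $(\mu\otimes\mu)R=R(\mu\otimes\mu)$ and $\mathrm{Tr}_2(R^{\pm1}(\mu\otimes\mu))=\alpha^{\pm1}\beta\mu$, where $\mathrm{Tr}_2$ is the partial trace over the second tensor factor. LEYBO: a Laurent deformation $(\tilde R_{(N)},\tilde R^{-1}_{(N)})$ such that $\tilde R_{(N)}$ and $\tilde R^{-1}_{(N)}$ are both enhanced YBOs, with data $\alpha$, $\beta$ and $\tilde\mu=\sum_i\hbar^i\mu_i$. Quantum cocycle invariant from a LEYBO: if $b_m$ is an $m$-braid whose closure is $K$, with writhe $w(b_m)$ (positive minus negative crossings), and $\Psi_{(\tilde R_{(N)},\tilde R^{-1}_{(N)})}$ is the braid group representation $\sigma_i^{\pm1}\mapsto\mathbb 1^{\otimes(i-1)}\otimes\tilde R_{(N)}^{\pm1}\otimes\mathbb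 1^{\otimes(m-i-1)}$, then $$\Phi_{(\tilde R_{(N)},\tilde R^{-1}_{(N)})}(K)=\alpha^{-w(b_m)}\beta^{-m}\,\mathrm{Tr}\big(\Psi_{(\tilde R_{(N)},\tilde R^{-1}_{(N)})}(b_m)\,\tilde\mu^{\otimes m}\big),$$ i.e. the sum of the terms with $\mu_{j_1}\otimes\cdots\otimes\mu_{j_m}$ over the components $\mu_j$ of $\tilde\mu$, collected by degree in $\hbar$.
   Formalization: Φ as defined already contains the factor ħ^{m⁺-m⁻-n}, so the display is proved with the unnormalized trace in place of Φ, together with (ħ+ħ⁻¹)J=Φ; 𝕜 is commutative, 𝒱 is 𝕜[ħ,ħ⁻¹], and the sign of J is chosen so that the 2-component unlink has J=ħ+ħ⁻¹. *)

(* Defs.v *)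
From HB Require Import structures.
From mathcomp Require Import all_boot all_algebra.
From mathcomp Require Import generic_quotient qpoly mxtens boolp ring.

Set Implicit Arguments.
Unset Strict Implicit.
Unset Printing Implicit Defensive.

Import GRing.Theory.
Local Open Scope ring_scope.

(* [k[hbar, hbar^-1]] is built, for an arbitrary commutative ring [k], as the
   localization of [{poly k}] at ['X]: the pair [(p, m)] stands for
   [p / hbar^m].  Since ['X] is regular, [(p, m)] and [(q, l)] are equal iff
   [p * 'X^l = q * 'X^m].  This ring is the home of Laurent deformations of
   finite order: in k[[hbar, hbar']] the element hbar * hbar' - 1 is
   invertible, so the quotient by it has to be formed from polynomials. *)

Module Laurent.
Section Laurent.
Local Open Scope quotient_scope.
Variable k : comNzRingType.

Local Notation pre := ({poly k} * nat)%type.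
Implicit Types x y z : pre.

Definition equivl x y := x.1 * 'X^(y.2) == y.1 * 'X^(x.2).

Lemma equivl_refl : reflexive equivl.
Proof. by move=> x; rewrite /equivl. Qed.

Lemma equivl_sym : symmetric equivl.
Proof. by move=> x y; rewrite /equivl eq_sym. Qed.

Lemma mulXn_inj n : injective (fun p : {poly k} => p * 'X^n).
Proof.
by move=> p q /polyP epq; apply/polyP=> i;
   have := epq (i + n)%N; rewrite !coefMXn ltnNge leq_addl /= addnK.
Qed.

Lemma equivl_trans : transitive equivl.
Proof.
move=> [y b] [x a] [z c]; rewrite /equivl /= => /eqP xy /eqP yz; apply/eqP.
apply: (@mulXn_inj b) => /=.
by rewrite mulrAC xy mulrAC yz mulrAC.
Qed.

Canonical equivl_equiv := EquivRel equivl equivl_refl equivl_sym equivl_trans.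

Definition type := {eq_quot equivl}.

HB.instance Definition _ : EqQuotient _ equivl type := EqQuotient.on type.
HB.instance Definition _ := Choice.on type.


Lemma equivl_repr x :
  (repr (\pi_type x)).1 * 'X^(x.2) = x.1 * 'X^((repr (\pi_type x)).2).
Proof. by apply/eqP; have /eqmodP := reprK (\pi_type x). Qed.

Definition embed := lift_embed type (fun p : {poly k} => (p, 0%N)).
Canonical embed_pi_morph := PiEmbed embed.

Definition addl x y : pre := (x.1 * 'X^(y.2) + y.1 * 'X^(x.2), (x.2 + y.2)%N).
Definition add := lift_op2 type addl.
Lemma pi_add : {morph \pi : x y / addl x y >-> add x y}.
Proof.
move=> x y; unlock add; apply/eqmodP => /=; rewrite /equivl /addl /=.
have := equivl_repr x; have := equivl_repr y.
case: (repr _) => q l /= Eq; case: (repr _) => p m /= Ep.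
apply/eqP; rewrite !mulrDl !exprD.
transitivity ((x.1 * 'X^m) * ('X^(y.2) * 'X^l) + (y.1 * 'X^l) * ('X^(x.2) * 'X^m)).
  by congr (_ + _); [exact: mulrACA | rewrite ['X^m * _]mulrC; exact: mulrACA].
rewrite -Ep -Eq; congr (_ + _); first by rewrite ['X^(y.2) * _]mulrC mulrACA.
by rewrite ['X^(x.2) * 'X^m]mulrC mulrACA ['X^(y.2) * _]mulrC.
Qed.
Canonical pi_add_morph := PiMorph2 pi_add.

Definition oppl x : pre := (- x.1, x.2).
Definition opp := lift_op1 type oppl.
Lemma pi_opp : {morph \pi : x / oppl x >-> opp x}.
Proof.
move=> x; unlock opp; apply/eqmodP => /=; rewrite /equivl /oppl /=.
by rewrite !mulNr equivl_repr.
Qed.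
Canonical pi_opp_morph := PiMorph1 pi_opp.

Definition mull x y : pre := (x.1 * y.1, (x.2 + y.2)%N).
Definition mul := lift_op2 type mull.
Lemma pi_mul : {morph \pi : x y / mull x y >-> mul x y}.
Proof.
move=> x y; unlock mul; apply/eqmodP => /=; rewrite /equivl /mull /=.
by rewrite !exprD mulrACA -!equivl_repr mulrACA.
Qed.
Canonical pi_mul_morph := PiMorph2 pi_mul.

Fact addA : associative add.
Proof.
elim/quotW=> x; elim/quotW=> y; elim/quotW=> z; apply/eqP.
by rewrite !piE /equivl /addl /= !exprD; apply/eqP; ring.
Qed.

Fact addC : commutative add.
Proof.
by elim/quotW=> x; elim/quotW=> y; rewrite !piE /addl addrC addnC.
Qed.

Fact add0 : left_id (embed 0) add.
Proof.
elim/quotW=> [[p m]]; rewrite !piE /addl /=.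
by rewrite mul0r add0r mulr1 add0n.
Qed.

Fact addN : left_inverse (embed 0) opp add.
Proof.
elim/quotW=> x; apply/eqP; rewrite piE /equivl /addl /oppl /=.
by rewrite mulNr addNr !mul0r.
Qed.

HB.instance Definition _ := GRing.isZmodule.Build type addA addC add0 addN.

Fact mulA : associative mul.
Proof.
elim/quotW=> x; elim/quotW=> y; elim/quotW=> z.
by rewrite !piE /mull mulrA addnA.
Qed.

Fact mulC : commutative mul.
Proof.
by elim/quotW=> x; elim/quotW=> y; rewrite !piE /mull mulrC addnC.
Qed.

Fact mul1 : left_id (embed 1) mul.
Proof. by elim/quotW=> [[p m]]; rewrite !piE /mull mul1r. Qed.

Fact mulD : left_distributive mul add.
Proof.
elim/quotW=> x; elim/quotW=> y; elim/quotW=> z; apply/eqP.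
by rewrite !piE /equivl /mull /addl /= !exprD; apply/eqP; ring.
Qed.

Fact one_neq0 : embed 1 != embed 0.
Proof. by rewrite piE /equivl /= !mulr1 oner_eq0. Qed.

HB.instance Definition _ :=
  GRing.Zmodule_isComNzRing.Build type mulA mulC mul1 mulD one_neq0.

(* Invertibility is not decidable for a general [k], hence the classical
   choice of an inverse. *)
Definition unit : pred type := fun a => `[< exists b, b * a = 1 >].
Definition inv (a : type) : type :=
  if pselect (exists b, b * a = 1) is left e then projT1 (cid e) else a.

Fact mulVl : {in unit, left_inverse 1 inv *%R}.
Proof.
move=> a /asboolP ea; rewrite /inv; case: pselect => [e|//].
exact: (projT2 (cid e)).
Qed.

Fact unitPl a b : b * a = 1 -> unit a.
Proof. by move=> ba; apply/asboolP; exists b. Qed.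

Fact inv_out : {in [predC unit], inv =1 id}.
Proof.
move=> a; rewrite !inE => /asboolP na; rewrite /inv.
by case: pselect => [e|//]; case: na.
Qed.

HB.instance Definition _ :=
  GRing.ComNzRing_hasMulInverse.Build type mulVl unitPl inv_out.

Fact embed_zmod : zmod_morphism embed.
Proof.
move=> p q; unlock embed.
by rewrite -[X in _ = _ + X]pi_opp -[RHS]pi_add /addl /= !mulr1.
Qed.

Fact embed_monoid : monoid_morphism embed.
Proof. by split=> [//|p q]; unlock embed; rewrite -[RHS]pi_mul. Qed.

HB.instance Definition _ := GRing.isZmodMorphism.Build {poly k} type embed
  embed_zmod.
HB.instance Definition _ := GRing.isMonoidMorphism.Build {poly k} type embed
  embed_monoid.

End Laurent.
End Laurent.
HB.export Laurent.

Notation laurent := Laurent.type.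

Definition lconst (k : comNzRingType) (c : k) : laurent k :=
  Laurent.embed c%:P.

Definition hbar (k : comNzRingType) : laurent k := Laurent.embed 'X.

Lemma hbar_unit (k : comNzRingType) : hbar k \is a GRing.unit.
Proof.
apply/Laurent.unitPl; instantiate (1 := (\pi_(laurent k) (1, 1%N))%qT).
rewrite /hbar; unlock Laurent.embed; rewrite -[LHS]Laurent.pi_mul.
apply/eqP; rewrite -[X in _ == X]/(Laurent.embed (1 : {poly k})) piE.
by rewrite /Laurent.equivl /Laurent.mull /= mulr1 mulrC.
Qed.

(* [V] is the free module of rank [d] over a commutative ring [A], an
   endomorphism of [V^{(x) n}] is a matrix of size [d ^ n], and the tensor
   product is [*t]. *)

Section YangBaxter.
Variables (A : comNzRingType) (d : nat).
Implicit Type R : 'M[A]_(d * d).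

Definition R12 R : 'M[A]_(d * d * d) := R *t (1%:M : 'M_d).

Definition R23 R : 'M[A]_(d * d * d) :=
  castmx (mulnA d d d, mulnA d d d) ((1%:M : 'M_d) *t R).

Definition pre_YBO R :=
  R12 R *m R23 R *m R12 R = R23 R *m R12 R *m R23 R.

Definition ptrace2 (M : 'M[A]_(d * d)) : 'M[A]_d :=
  \matrix_(i, j) \sum_(l < d) M (mxtens_index (i, l)) (mxtens_index (j, l)).

End YangBaxter.

Definition enhanced_YBO (A : comUnitRingType) (d : nat)
    (R : 'M[A]_(d * d)) (alpha beta : A) (mu : 'M[A]_d) : Prop :=
  [/\ pre_YBO R /\ R \in unitmx,
      alpha \is a GRing.unit /\ beta \is a GRing.unit,
      (mu *t mu) *m R = R *m (mu *t mu),
      ptrace2 (R *m (mu *t mu)) = (alpha * beta) *: mu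
    & ptrace2 (invmx R *m (mu *t mu)) = (alpha^-1 * beta) *: mu].

Section Deformation.
Variables (k : comNzRingType) (m : nat).

Definition poly_series (n : nat) (phi : nat -> 'M[k]_m) : 'M[{poly k}]_m :=
  \sum_(i < n.+1) 'X^i *: map_mx polyC (phi i).

(* Reduction modulo ['X^(n+1)]: [k[[hbar]]/(hbar^(n+1))] is the truncated
   polynomial ring [{poly %/ 'X^(n.+1)}]. *)
Definition trunc_series (n : nat) (phi : nat -> 'M[k]_m) :
    'M[{poly %/ ('X^(n.+1) : {poly k})}]_m :=
  map_mx (in_qpoly ('X^(n.+1) : {poly k})) (poly_series n phi).

Definition laurent_series (x : laurent k) (n : nat) (phi : nat -> 'M[k]_m) :
    'M[laurent k]_m :=
  \sum_(i < n.+1) x ^+ i *: map_mx (@lconst k) (phi i).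

End Deformation.

(* The Yang--Baxter operator [laurent_series hbar N phi], with inverse
   [laurent_series hbar^-1 N phihat], is obtained by a Laurent deformation of
   order [N] of the pre-Yang--Baxter operators [phi 0] and [phihat 0]. *)
Definition laurent_deformation (k : comNzRingType) (d N : nat)
    (phi phihat : nat -> 'M[k]_(d * d)) : Prop :=
  let R := laurent_series (hbar k) N phi in
  let Rinv := laurent_series (hbar k)^-1 N phihat in
  [/\ forall n, (n <= N)%N -> pre_YBO (trunc_series n phi),
      forall n, (n <= N)%N -> pre_YBO (trunc_series n phihat),
      pre_YBO R, pre_YBO Rinv
    & R *m Rinv = 1%:M /\ Rinv *m R = 1%:M].

Record LEYBO (k : comNzRingType) := MkLEYBO {
  dimV : nat;
  order : nat;
  phi : nat -> 'M[k]_(dimV * dimV);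
  phihat : nat -> 'M[k]_(dimV * dimV);
  mu_coef : nat -> 'M[k]_dimV;
  alpha : laurent k;
  beta : laurent k;
  Rtilde := laurent_series (hbar k) order phi;
  Rtilde_inv := laurent_series (hbar k)^-1 order phihat;
  mu := laurent_series (hbar k) order mu_coef;
  deformationP : laurent_deformation order phi phihat;
  enhancedP : enhanced_YBO Rtilde alpha beta mu;
  enhanced_invP : enhanced_YBO Rtilde_inv alpha^-1 beta mu
}.

(* [braid n] is the type of braid words on [n.+1] strings: the letter
   [(i, true)] is the generator sigma_(i+1), a positive crossing, and
   [(i, false)] its inverse, a negative crossing.  By the theorems of
   Alexander and Markov, oriented links are the classes of closed braids for
   [same_link]. *)

Definition braid (n : nat) := seq ('I_n * bool).

Definition npos n (b : braid n) : nat := count (fun x => x.2) b.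
Definition nneg n (b : braid n) : nat := count (fun x => ~~ x.2) b.
Definition writhe n (b : braid n) : int := (npos b)%:Z - (nneg b)%:Z.

Definition add_string n (b : braid n) : braid n.+1 :=
  [seq (widen_ord (leqnSn n) x.1, x.2) | x <- b].

Inductive same_link : forall m n, braid m -> braid n -> Prop :=
| SL_refl n (b : braid n) : same_link b b
| SL_sym m n (b : braid m) (c : braid n) : same_link b c -> same_link c b
| SL_trans m n p (b : braid m) (c : braid n) (e : braid p) :
    same_link b c -> same_link c e -> same_link b e
| SL_cancel n (u v : braid n) (i : 'I_n) s :
    same_link (u ++ [:: (i, s); (i, ~~ s)] ++ v) (u ++ v)
| SL_far n (u v : braid n) (i j : 'I_n) : (i.+1 < j)%N ->
    same_link (u ++ [:: (i, true); (j, true)] ++ v)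
              (u ++ [:: (j, true); (i, true)] ++ v)
| SL_braid n (u v : braid n) (i j : 'I_n) : j = i.+1 :> nat ->
    same_link (u ++ [:: (i, true); (j, true); (i, true)] ++ v)
              (u ++ [:: (j, true); (i, true); (j, true)] ++ v)
| SL_conj n (u v : braid n) : same_link (u ++ v) (v ++ u)
| SL_stab n (u : braid n) s :
    same_link u (rcons (add_string u) (ord_max, s)).

(* [s] is t^(1/2).  It is the square root of t for which the unlink with [c]
   components has Jones polynomial [(s + s^-1) ^+ c.-1]; for the other square
   root, [- s], the right-hand side of the skein relation is [s - s^-1] and the
   polynomial of a link with [c] components is multiplied by [(-1) ^+ c.-1]. *)
Definition jones_polynomial (A : comUnitRingType) (s : A)
    (J : forall n, braid n -> A) : Prop :=
  [/\ forall m n (b : braid m) (c : braid n), same_link b c -> J m b = J n c,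
      J 0%N [::] = 1
    & forall n (u v : braid n) (i : 'I_n),
        s ^- 2 * J n (u ++ (i, true) :: v) - s ^+ 2 * J n (u ++ (i, false) :: v)
          = (s^-1 - s) * J n (u ++ v)].

Section Invariant.
Variables (k : comNzRingType) (L : LEYBO k).
Let d := dimV L.

Lemma braid_gen_dim n (i : 'I_n) :
  (d ^ i * (d * d) * d ^ (n - i.+1) = d ^ n.+1)%N.
Proof.
rewrite mulnA -!expnSr -expnD; congr (d ^ _)%N.
by rewrite addSn subnKC.
Qed.

(* The operator [1^{(x) i} (x) R (x) 1^{(x) (n - i - 1)}] on the [n.+1]-st
   tensor power of [V]. *)
Definition braid_gen n (R : 'M[laurent k]_(d * d)) (i : 'I_n) :
    'M[laurent k]_(d ^ n.+1) :=
  castmx (braid_gen_dim i, braid_gen_dim i)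
    ((1%:M : 'M_(d ^ i)) *t R *t (1%:M : 'M_(d ^ (n - i.+1)))).

Definition braid_rep n (b : braid n) : 'M[laurent k]_(d ^ n.+1) :=
  \big[mulmx/1%:M]_(x <- b)
     braid_gen (if x.2 then Rtilde L else Rtilde_inv L) x.1.

(* The quantum cocycle invariant before the normalization by [alpha] and
   [beta]; unlike [quantum_invariant] it depends on the closed braid diagram
   and not only on the link. *)
Definition state_trace n (b : braid n) : laurent k :=
  \tr (braid_rep b *m (mu L) ^t n.+1).

Definition quantum_invariant n (b : braid n) : laurent k :=
  alpha L ^ (- writhe b) * beta L ^ (- n.+1%:Z) * state_trace b.

End Invariant.

(* Main.v *)
Require Import Defs.
From mathcomp Require Import all_boot all_algebra.
From mathcomp Require Import generic_quotient qpoly mxtens boolp zify ring.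

Set Implicit Arguments.
Unset Strict Implicit.
Unset Printing Implicit Defensive.

Import GRing.Theory.
Local Open Scope ring_scope.

(** The Jones polynomial comes from the six-vertex solution of the Yang-Baxter
    equation, which Kauffman's bracket writes as R = 1 - U with U the product of
    a column by a row.  Let W be the matrix with rows (0, a) and (- b, 0),
    let w be the row vector on V (x) V with the entries of W, and U = w^T w.
    Then U^2 = (a^2 + b^2) U, and since W^2 = - a b the zigzag of cups and caps
    gives U1 U2 U1 = (a b)^2 U1: this is a Temperley-Lieb algebra.  Expanding
    (1 - U1)(1 - U2)(1 - U1), the Yang-Baxter equation holds as soon as
    a^2 + b^2 = 1 + (a b)^2, that is (1 - a^2)(1 - b^2) = 0
    ([pre_YBO_jonesR]).  The choice (a, b) = (1, hbar) is a polynomial of degree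
    2 in hbar; its inverse is the choice (hbar^-1, 1), a polynomial of degree 2
    in hbar^-1.  As the Yang-Baxter equation holds over every commutative ring,
    it also holds in all truncations, so this is a Laurent deformation of order
    2, and mu = diag(1, hbar^2), alpha = hbar^-1, beta = hbar enhance it
    ([jones_LEYBO]).

    The quantum invariant of any LEYBO is unchanged by Markov moves
    ([quantum_invariant_same_link]): the relations of the braid group follow
    from the Yang-Baxter equation and from R R^-1 = 1, conjugation from the
    cyclicity of the trace, and stabilization from the partial trace condition.
    For the LEYBO above hbar^-1 R - hbar R^-1 is the scalar hbar^-1 - hbar, and
    this is the skein relation; the value at the unknot is hbar + hbar^-1.

    It remains to compare with an arbitrary Jones polynomial, and to construct
    one.  Both follow from [skein_determined]: a link invariant with the skein
    relation takes at each braid b the value c(b) times its value at the unknot,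
    where c(b) does not depend on the invariant.  This is the uniqueness of the
    Ocneanu trace on Hecke algebras, proved on braid words: the skein relation
    makes all crossings positive, the Hecke relations leave at most one
    occurrence of the last generator, and this occurrence is removed by
    conjugation and destabilization; if there is none, the last string is split
    off.  Hence hbar + hbar^-1 times a Jones polynomial is the quantum invariant,
    and c is a Jones polynomial, because hbar + hbar^-1 is not a zero divisor
    and the quantum invariant is (hbar + hbar^-1) c. *)

(** * Square matrices as a strict monoidal category *)
Section SquareMatrices.
Variable A : comNzRingType.

(** With the size bundled, the tensor product is associative and unital up to
    equality, and the casts between d ^ (p + q) and d ^ p * d ^ q disappear. *)
Definition sqmx := {m : nat & 'M[A]_m}.
Definition Sq m (M : 'M[A]_m) : sqmx := existT (fun m => 'M[A]_m) m M.
Definition sdim (X : sqmx) : nat := tag X.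
Definition sid m : sqmx := Sq (1%:M : 'M_m).
Definition stens (X Y : sqmx) : sqmx := Sq (tagged X *t tagged Y).
(** The value is the matrix product when the sizes agree and 0 otherwise. *)
Definition scomp (X Y : sqmx) : sqmx :=
  Sq (tagged X *m conform_mx (0 : 'M_(tag X)) (tagged Y)).
Definition strace (X : sqmx) : A := \tr (tagged X).

End SquareMatrices.

Local Notation "X \ox Y" := (stens X Y) (at level 40, left associativity).
Local Notation "X \oc Y" := (scomp X Y) (at level 50, left associativity).

Section SquareMatricesTheory.
Variable A : comNzRingType.
Implicit Types X Y Z T : sqmx A.

Lemma Sq_inj m : injective (@Sq A m).
Proof. by move=> M N /eqP; rewrite -tag_eqE /tag_eq eqxx /= tagged_asE => /eqP. Qed.

Lemma Sq_castmx m n (e : (m = n) * (m = n)) (M : 'M[A]_m) : Sq (castmx e M) = Sq M.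
Proof.
case: e => e e'; case: n / e in e' *.
by rewrite (eq_axiomK e') castmx_id.
Qed.

Lemma eq_Sq m n (M : 'M[A]_m) (N : 'M[A]_n) (e : m = n) :
  (forall i j, M i j = N (cast_ord e i) (cast_ord e j)) -> Sq M = Sq N.
Proof.
case: n / e N => N eMN; congr Sq; apply/matrixP => i j.
by rewrite eMN !cast_ord_id.
Qed.

Lemma scompE m (M N : 'M[A]_m) : Sq M \oc Sq N = Sq (M *m N).
Proof. by rewrite /scomp conform_mx_id. Qed.

Lemma sdim_scomp X Y : sdim (X \oc Y) = sdim X.
Proof. by []. Qed.

Lemma sdim_stens X Y : sdim (X \ox Y) = (sdim X * sdim Y)%N.
Proof. by []. Qed.

Lemma sdim_Sq m (M : 'M[A]_m) : sdim (Sq M) = m.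
Proof. by []. Qed.

Definition sdimE := (sdim_scomp, sdim_stens, sdim_Sq).

Lemma scomp1l X : sid A (sdim X) \oc X = X.
Proof. by case: X => m M; rewrite scompE mul1mx. Qed.

Lemma scomp1r X : X \oc sid A (sdim X) = X.
Proof. by case: X => m M; rewrite scompE mulmx1. Qed.

Lemma stensA X Y Z : X \ox (Y \ox Z) = X \ox Y \ox Z.
Proof.
case: X Y Z => [m M] [n N] [p P]; apply: (eq_Sq (e := mulnA m n p)) => /= i j.
case: (mxtens_indexP i) => a i'; case: (mxtens_indexP i') => b c.
case: (mxtens_indexP j) => a' j'; case: (mxtens_indexP j') => b' c'.
have E (x : 'I_m) (y : 'I_n) (z : 'I_p) :
    cast_ord (mulnA m n p) (mxtens_index (x, mxtens_index (y, z))) =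
    mxtens_index (mxtens_index (x, y), z).
  by apply: val_inj; rewrite /= mulnDl mulnA addnA.
by rewrite !E !tensmxE mulrA.
Qed.

Lemma stens1l X : sid A 1 \ox X = X.
Proof. by case: X => m M; rewrite /stens /= tens_scalar1mx Sq_castmx. Qed.

Lemma stens1r X : X \ox sid A 1 = X.
Proof.
by case: X => m M; rewrite /stens /= tens_mx_scalar scale1r Sq_castmx.
Qed.

Lemma tens1mx1 m n : (1%:M : 'M[A]_m) *t (1%:M : 'M_n) = 1%:M.
Proof.
apply/matrixP => i j; case: (mxtens_indexP i) => a b.
case: (mxtens_indexP j) => a' b'; rewrite tensmxE !mxE.
by rewrite (can_eq (@mxtens_indexK m n)) xpair_eqE -natrM mulnb.
Qed.

Lemma stens_id m n : sid A m \ox sid A n = sid A (m * n).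
Proof. by rewrite /stens /= tens1mx1. Qed.

Lemma stens_comp X Y Z T : sdim X = sdim Z -> sdim Y = sdim T ->
  (X \ox Y) \oc (Z \ox T) = (X \oc Z) \ox (Y \oc T).
Proof.
case: X Y Z T => [m M] [n N] [p P] [q Q]; rewrite /sdim /= => e e'.
case: p / e P => P; case: q / e' Q => Q.
by rewrite /stens !scompE tensmx_mul.
Qed.

Lemma sum_mxtens m n (F : 'I_(m * n) -> A) :
  \sum_i F i = \sum_i \sum_j F (mxtens_index (i, j)).
Proof.
rewrite pair_big /= (reindex (fun x => mxtens_index (x.1, x.2))) //.
exists (@mxtens_unindex m n) => i _; last exact: mxtens_unindexK.
by rewrite mxtens_indexK; case: i.
Qed.

(** An operator that acts trivially on the last factor can be moved out of the
    partial trace over it. *)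
Lemma strace_ptrace2 d p X (M : 'M[A]_p) (S : 'M[A]_(d * d)) : sdim X = (p * d)%N ->
  strace ((X \ox sid A d) \oc (Sq M \ox Sq S)) = strace (X \oc (Sq M \ox Sq (ptrace2 S))).
Proof.
case: X => m U; rewrite /sdim /= => e; move: U; rewrite e => {e m} U.
have -> : Sq M \ox Sq S = Sq (castmx (mulnA p d d, mulnA p d d) (M *t S)).
  by rewrite Sq_castmx.
rewrite /stens !scompE /strace /= /mxtrace sum_mxtens; apply: eq_bigr => x _.
under eq_bigr do rewrite mxE sum_mxtens.
rewrite mxE exchange_big; apply: eq_bigr => y _ /=.
have E (z : 'I_(p * d)) l : cast_ord (esym (mulnA p d d)) (mxtens_index (z, l)) =
    mxtens_index ((mxtens_unindex z).1, mxtens_index ((mxtens_unindex z).2, l)).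
  case: (mxtens_indexP z) => b c; rewrite mxtens_indexK.
  by apply: val_inj; rewrite /= mulnDl mulnA addnA.
case: (mxtens_indexP x) (E x) => a b E1; case: (mxtens_indexP y) (E y) => a' b' E2.
rewrite mxtens_indexK in E1; rewrite mxtens_indexK in E2.
rewrite tensmxE mxE !mulr_sumr; apply: eq_bigr => l _.
rewrite (bigD1 l) //= big1 ?addr0 => [|l' nl]; last first.
  by rewrite tensmxE mxE eq_sym (negbTE nl) mulr0 mul0r.
by rewrite tensmxE mxE eqxx mulr1 castmxE E1 E2 tensmxE.
Qed.

Lemma strace_stensZ p q X (M : 'M[A]_p) (N : 'M[A]_q) c : sdim X = (p * q)%N ->
  strace (X \oc (Sq M \ox Sq (c *: N))) = c * strace (X \oc (Sq M \ox Sq N)).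
Proof.
case: X => m U; rewrite /sdim /= => e; move: U; rewrite e => {e m} U.
have EZ : M *t (c *: N) = c *: (M *t N).
  by apply/matrixP => i j; rewrite !mxE mulrCA.
by rewrite /stens /= EZ !scompE /strace /= -scalemxAr mxtraceZ.
Qed.

End SquareMatricesTheory.

(** * Traces of braid operators and Markov moves *)

(* Unification must not look for tensor products inside the matrices. *)
Local Opaque stens scomp.

Section BraidOperators.
Variables (A : comUnitRingType) (d : nat).
Implicit Types R : 'M[A]_(d * d).

Definition idV p := sid A (d ^ p).

Lemma idV_add p q : idV (p + q) = idV p \ox idV q.
Proof. by rewrite /idV stens_id expnD. Qed.

Lemma idV2 : idV 2 = sid A (d * d).
Proof. by rewrite /idV -(mulnn d). Qed.

Lemma idV_comp p : idV p \oc idV p = idV p.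
Proof. by rewrite /idV scompE mul1mx. Qed.

Lemma idV_compl p (M : 'M_(d ^ p)) : idV p \oc Sq M = Sq M.
Proof. exact: scomp1l (Sq M). Qed.

Lemma idV_compr p (M : 'M_(d ^ p)) : Sq M \oc idV p = Sq M.
Proof. exact: scomp1r (Sq M). Qed.

Lemma pad_comp p q (X Y : sqmx A) : sdim X = sdim Y ->
  (idV p \ox X \ox idV q) \oc (idV p \ox Y \ox idV q) = idV p \ox (X \oc Y) \ox idV q.
Proof.
move=> eXY; have e : sdim (idV p \ox X) = sdim (idV p \ox Y) by rewrite !sdimE eXY.
by rewrite stens_comp ?sdimE // idV_comp stens_comp ?sdimE // idV_comp.
Qed.

Lemma pad_comp3 p q (X Y Z : sqmx A) : sdim X = sdim Y -> sdim Y = sdim Z ->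
  (idV p \ox X \ox idV q) \oc ((idV p \ox Y \ox idV q) \oc (idV p \ox Z \ox idV q)) =
  idV p \ox (X \oc (Y \oc Z)) \ox idV q.
Proof. by move=> eXY eYZ; rewrite (@pad_comp p q Y Z) // (@pad_comp p q X). Qed.

Lemma local_op_dim n (i : 'I_n) : (d ^ i * (d * d) * d ^ (n - i.+1) = d ^ n.+1)%N.
Proof. by rewrite mulnA -!expnSr -expnD addSn subnKC. Qed.

(** The action of R on the tensor factors i and i + 1. *)
Definition local_op n R (i : 'I_n) : 'M[A]_(d ^ n.+1) :=
  castmx (local_op_dim i, local_op_dim i)
    ((1%:M : 'M_(d ^ i)) *t R *t (1%:M : 'M_(d ^ (n - i.+1)))).

Lemma Sq_local_op n R (i : 'I_n) :
  Sq (local_op R i) = idV i \ox Sq R \ox idV (n - i.+1).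
Proof. by rewrite /local_op Sq_castmx. Qed.

Lemma local_op1 n (i : 'I_n) : local_op 1%:M i = 1%:M.
Proof.
apply: Sq_inj; rewrite Sq_local_op -[Sq 1%:M]idV2 -!idV_add; congr (idV _).
by have := ltn_ord i; lia.
Qed.

Lemma local_opM n (i : 'I_n) R R' :
  local_op R i *m local_op R' i = local_op (R *m R') i.
Proof.
by apply: Sq_inj; rewrite -scompE !Sq_local_op pad_comp ?sdimE // scompE.
Qed.

Lemma local_opD n (i : 'I_n) a b R R' :
  local_op (a *: R + b *: R') i = a *: local_op R i + b *: local_op R' i.
Proof.
apply/matrixP => x y; rewrite !mxE !castmxE !mxE /=; ring.
Qed.

(** Both operators are tensor products over the same five blocks of factors,
    and neither block of the one meets the block of the other. *)
Lemma local_op_far n (R R' : 'M[A]_(d * d)) (i j : 'I_n) : (i.+1 < j)%N ->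
  local_op R i *m local_op R' j = local_op R' j *m local_op R i.
Proof.
move=> ij; have jn := ltn_ord j; apply: Sq_inj.
have Eg : Sq (local_op R i) =
    idV i \ox Sq R \ox idV (j - i.+2) \ox sid A (d * d) \ox idV (n - j.+1).
  rewrite Sq_local_op (_ : n - i.+1 = (j - i.+2) + 2 + (n - j.+1))%N; last lia.
  by rewrite !idV_add idV2 !stensA.
have Eg' : Sq (local_op R' j) =
    idV i \ox sid A (d * d) \ox idV (j - i.+2) \ox Sq R' \ox idV (n - j.+1).
  rewrite Sq_local_op {1}(_ : j = i + 2 + (j - i.+2) :> nat)%N; last lia.
  by rewrite !idV_add idV2.
by rewrite -!scompE Eg Eg' !stens_comp ?sdimE // !scompE !mulmx1 !mul1mx.
Qed.

Lemma local_op_braid n R (i j : 'I_n) : pre_YBO R -> j = i.+1 :> nat ->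
  local_op R i *m (local_op R j *m local_op R i) =
  local_op R j *m (local_op R i *m local_op R j).
Proof.
move=> ybe ij; have jn := ltn_ord j; apply: Sq_inj.
have E12 : Sq R \ox sid A d = Sq (R12 R) by [].
have E23 : sid A d \ox Sq R = Sq (R23 R) by rewrite Sq_castmx.
have d1 : sid A d = idV 1 by [].
have Eg : Sq (local_op R i) = idV i \ox Sq (R12 R) \ox idV (n - j.+1).
  rewrite Sq_local_op (_ : n - i.+1 = 1 + (n - j.+1))%N; last lia.
  by rewrite idV_add -E12 d1 !stensA.
have Eg' : Sq (local_op R j) = idV i \ox Sq (R23 R) \ox idV (n - j.+1).
  rewrite Sq_local_op {1}(_ : j = i + 1 :> nat)%N; last lia.
  by rewrite idV_add -E23 d1 !stensA.
rewrite -!scompE Eg Eg'; rewrite /pre_YBO in ybe.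
move: (R12 R) (R23 R) ybe {E12 E23 Eg Eg'} => S T ybe.
have e : sdim (Sq S) = sdim (Sq T) by [].
rewrite (pad_comp3 _ _ e (esym e)) (pad_comp3 _ _ (esym e) e).
by rewrite !scompE !mulmxA ybe.
Qed.

(** The operators of a positive and of a negative crossing are [R true] and
    [R false]; m is the enhancement. *)
Variables (R : bool -> 'M[A]_(d * d)) (m : 'M[A]_d) (al be : A).
Hypothesis RV : forall s, R s *m R (~~ s) = 1%:M.
Hypothesis Rm : forall s, (m *t m) *m R s = R s *m (m *t m).
Hypothesis trR : forall s,
  ptrace2 (R s *m (m *t m)) = ((if s then al else al^-1) * be) *: m.

Definition braid_op n (b : braid n) : 'M[A]_(d ^ n.+1) :=
  \big[mulmx/1%:M]_(x <- b) local_op (R x.2) x.1.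
Definition braid_trace n (b : braid n) : A := \tr (braid_op b *m m ^t n.+1).

Lemma braid_op_nil n : braid_op ([::] : braid n) = 1%:M.
Proof. by rewrite /braid_op big_nil. Qed.

Lemma braid_op_cons n x (b : braid n) : braid_op (x :: b) =
  local_op (R x.2) x.1 *m braid_op b.
Proof. by rewrite /braid_op big_cons. Qed.

Lemma braid_op_cat n (u v : braid n) :
  braid_op (u ++ v) = braid_op u *m braid_op v.
Proof.
elim: u => [|x u IHu]; first by rewrite braid_op_nil mul1mx.
by rewrite /= !braid_op_cons IHu mulmxA.
Qed.

Lemma Sq_braid_op_add_string n (u : braid n) :
  Sq (braid_op (add_string u)) = Sq (braid_op u) \ox sid A d.
Proof.
elim: u => [|x u IHu].
  by rewrite !braid_op_nil [RHS]stens_id -expnSr.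
rewrite /= !braid_op_cons -!scompE IHu !Sq_local_op /=.
have xn := ltn_ord x.1.
rewrite (_ : n.+1 - x.1.+1 = n - x.1.+1 + 1)%N; last lia.
rewrite idV_add stensA.
have eX : sdim (idV x.1 \ox Sq (R x.2) \ox idV (n - x.1.+1)) = sdim (Sq (braid_op u)).
  by rewrite !sdimE (local_op_dim x.1).
have e1 : sdim (idV 1) = sdim (sid A d) by [].
by rewrite (stens_comp eX e1) [idV 1 \oc _]scompE mul1mx.
Qed.

Lemma Sq_ntens c (M : 'M[A]_c) p q :
  Sq (M ^t (p + q)) = Sq (M ^t p) \ox Sq (M ^t q).
Proof.
have ES r : Sq (M ^t r.+1) = Sq M \ox Sq (M ^t r).
  by case: r => [|r]; [rewrite ntensmx0 -/(sid A 1) stens1r ntensmx1 | rewrite ntensmxSS].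
elim: p => [|p IHp]; first by rewrite add0n ntensmx0 -/(sid A 1) stens1l.
by rewrite addSn !ES IHp stensA.
Qed.

Lemma mu_braid_op n (b : braid n) :
  m ^t n.+1 *m braid_op b = braid_op b *m m ^t n.+1.
Proof.
elim: b => [|[i s] b IHb]; first by rewrite braid_op_nil mul1mx mulmx1.
rewrite braid_op_cons /= mulmxA -[RHS]mulmxA -IHb [RHS]mulmxA; congr (_ *m _).
apply: Sq_inj; rewrite -!scompE Sq_local_op.
have -> : Sq (m ^t n.+1) = Sq (m ^t i) \ox Sq (m *t m) \ox Sq (m ^t (n - i.+1)).
  rewrite (_ : n.+1 = i + 2 + (n - i.+1))%N; last by have := ltn_ord i; lia.
  by rewrite !Sq_ntens ntensmx2.
by rewrite !stens_comp ?sdimE // !(idV_compl, idV_compr) !scompE Rm.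
Qed.

(** The enhancement commutes with braid operators, so that the trace weighted by
    it is cyclic on braids. *)
Lemma braid_trace_conj n (u v : braid n) :
  braid_trace (u ++ v) = braid_trace (v ++ u).
Proof.
rewrite /braid_trace !braid_op_cat -mulmxA mxtrace_mulC.
by rewrite -[LHS]/(\tr (_ *m _ *m _)) -[in LHS]mulmxA mu_braid_op mulmxA.
Qed.

(** The last crossing is the only operator on the last factor: its partial trace
    there gives back the enhancement, up to a scalar. *)
Lemma braid_trace_stab n (u : braid n) s :
  braid_trace (rcons (add_string u) (ord_max, s)) =
  (if s then al else al^-1) * be * braid_trace u.
Proof.
rewrite /braid_trace -cats1 braid_op_cat braid_op_cons braid_op_nil mulmx1 /=.
have tr_strace c (M : 'M[A]_c) : \tr M = strace (Sq M) by [].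
rewrite !tr_strace -mulmxA -!scompE Sq_braid_op_add_string Sq_local_op subnn stens1r.
have -> : Sq (m ^t n.+2) = Sq (m ^t n) \ox Sq (m *t m).
  by rewrite -addn2 Sq_ntens ntensmx2.
rewrite stens_comp // idV_compl scompE strace_ptrace2; last by rewrite sdimE expnSr.
have -> : Sq (m ^t n.+1) = Sq (m ^t n) \ox Sq m by rewrite -addn1 Sq_ntens ntensmx1.
rewrite trR.
by rewrite strace_stensZ // sdimE expnSr.
Qed.

Hypotheses (al_unit : al \is a GRing.unit) (be_unit : be \is a GRing.unit).
Hypothesis ybe : pre_YBO (R true).

(** The scalar of a stabilization is compensated by the writhe, for alpha, and
    by the number of strings, for beta. *)
Definition normalized_trace n (b : braid n) : A :=
  al ^ (- writhe b) * be ^ (- n.+1%:Z) * braid_trace b.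

Lemma writhe_cat n (u v : braid n) : writhe (u ++ v) = writhe u + writhe v.
Proof. by rewrite /writhe /npos /nneg !count_cat !PoszD opprD addrACA. Qed.

Lemma writhe1 n (x : 'I_n * bool) : writhe [:: x] = if x.2 then 1 else -1.
Proof. by case: x => i [] /=; rewrite /writhe /npos /nneg /= ?subr0 ?sub0r. Qed.

Lemma normalized_trace_local n (u v c c' : braid n) :
  writhe c = writhe c' -> braid_op c = braid_op c' ->
  normalized_trace (u ++ c ++ v) = normalized_trace (u ++ c' ++ v).
Proof.
by move=> Ew Er; rewrite /normalized_trace /braid_trace !writhe_cat !braid_op_cat Ew Er.
Qed.

Lemma normalized_trace_same_link p q (b : braid p) (c : braid q) :
  same_link b c -> normalized_trace b = normalized_trace c.
Proof.
elim=> {p q b c} //.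
- by move=> m1 n p b c e _ -> _ ->.
- move=> n u v i s; apply: (@normalized_trace_local _ u v [:: (i, s); (i, ~~ s)] [::]).
    by rewrite -cat1s writhe_cat !writhe1; case: s.
  by rewrite !braid_op_cons braid_op_nil /= mulmx1 local_opM RV local_op1.
- move=> n u v i j ij; apply: normalized_trace_local.
    by rewrite -[in LHS]cat1s -[in RHS]cat1s !writhe_cat !writhe1.
  by rewrite !braid_op_cons braid_op_nil /= !mulmx1 local_op_far.
- move=> n u v i j ij; apply: normalized_trace_local => //.
  by rewrite !braid_op_cons braid_op_nil /= !mulmx1 local_op_braid.
- move=> n u v; rewrite /normalized_trace braid_trace_conj !writhe_cat addrC //.
- move=> n u s; rewrite /normalized_trace braid_trace_stab -cats1 writhe_cat writhe1 /=.
  have -> : writhe (add_string u) = writhe u.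
    by rewrite /writhe /npos /nneg !count_map.
  have Ea : al ^ (- (if s then 1 else -1)) * (if s then al else al^-1) = 1.
    by case: s; rewrite ?opprK ?expr1z ?exprN1 (mulVr, divrr).
  have Eb : be ^ (- n.+2%:Z) * be = be ^ (- n.+1%:Z).
    by rewrite -[X in _ * X]expr1z -exprzDr // -[n.+2]addn1 PoszD opprD addrNK.
  rewrite [in RHS]opprD [in RHS]exprzDr // -Eb.
  rewrite [RHS](_ : _ = al ^ (- writhe u) * (be ^ (- n.+2%:Z) * be) * braid_trace u *
    (al ^ (- (if s then 1 else -1)) * (if s then al else al^-1))); last by ring.
  by rewrite Ea mulr1.
Qed.

(** A linear relation between the two crossing operators and the identity is a
    skein relation for the normalized trace: a crossing changes the writhe by
    one, whence the factors alpha and alpha^-1. *)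
Lemma normalized_trace_skein n (u v : braid n) i a b c :
  a *: R true + b *: R false = c%:M ->
  a * al * normalized_trace (u ++ (i, true) :: v) +
    b * al^-1 * normalized_trace (u ++ (i, false) :: v) =
  c * normalized_trace (u ++ v).
Proof.
move=> Rskein; rewrite -[(i, true) :: v]cat1s -[(i, false) :: v]cat1s.
have rep1 s : braid_op [:: (i, s)] = local_op (R s) i.
  by rewrite braid_op_cons braid_op_nil mulmx1.
have trace_skein : a * braid_trace (u ++ [:: (i, true)] ++ v) +
    b * braid_trace (u ++ [:: (i, false)] ++ v) = c * braid_trace (u ++ v).
  pose K := braid_op v *m m ^t n.+1 *m braid_op u.
  have traceE c' : braid_trace (u ++ c' ++ v) = \tr (braid_op c' *m K).
    by rewrite /braid_trace !braid_op_cat -mulmxA mxtrace_mulC /K !mulmxA.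
  rewrite -[u ++ v]/(u ++ [::] ++ v) !traceE !rep1 braid_op_nil mul1mx.
  rewrite -!mxtraceZ -raddfD /= !scalemxAl -mulmxDl -local_opD Rskein.
  (* The scalar operator c is put in the form of a combination of two operators. *)
  rewrite -scalemx1 -[_ *: _]addr0 -[0](scale0r 1%:M) local_opD local_op1.
  by rewrite scale0r addr0 /K -!scalemxAl mul1mx.
have Ew t : writhe (u ++ [:: (i, t)] ++ v) = writhe (u ++ v) + (if t then 1 else -1).
  by rewrite !writhe_cat writhe1 addrCA addrC.
rewrite /normalized_trace !Ew; move: (writhe (u ++ v)) (be ^ _) => w c'.
have E1 : al ^ (- (w + 1)) = al^-1 * al ^ (- w).
  by rewrite opprD addrC exprzDr // exprN1.
have E2 : al ^ (- (w + -1)) = al * al ^ (- w).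
  by rewrite opprD opprK addrC exprzDr // expr1z.
rewrite E1 E2; move: (al ^ _) (braid_trace _) (braid_trace _) (braid_trace _)
  trace_skein => y t0 tm tp E.
rewrite [RHS](_ : _ = y * c' * (c * t0)); last by ring.
rewrite -E mulrDr; congr (_ + _).
  rewrite -[RHS]mulr1 -(divrr al_unit); ring.
rewrite -[RHS]mulr1 -(divrr al_unit); ring.
Qed.

End BraidOperators.

(** * The Temperley-Lieb relations *)
Section CapCup.
Variables (A : comNzRingType) (d : nat).
Implicit Types W : 'M[A]_d.

(** The bilinear form on V with Gram matrix W, as a linear form on V (x) V. *)
Definition cap W : 'rV[A]_(d * d) :=
  \row_j W (mxtens_unindex j).1 (mxtens_unindex j).2.

Definition cupcap W : 'M[A]_(d * d) := (cap W)^T *m cap W.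

Lemma capE W i j : cap W 0 (mxtens_index (i, j)) = W i j.
Proof. by rewrite mxE mxtens_indexK. Qed.

Lemma cupcapE W i j p q :
  cupcap W (mxtens_index (i, j)) (mxtens_index (p, q)) = W i j * W p q.
Proof. by rewrite mxE big_ord1 mxE !capE. Qed.

Lemma sum_deltal (n : nat) (r : 'I_n) (f : 'I_n -> A) : \sum_i (i == r)%:R * f i = f r.
Proof.
rewrite (bigD1 r) //= eqxx mul1r big1 ?addr0 // => i /negbTE ->.
exact: mul0r.
Qed.

(** The value of a closed loop. *)
Lemma cap_cup W : cap W *m (cap W)^T = (\tr (W *m W^T))%:M.
Proof.
apply/matrixP => i j; rewrite !ord1 !mxE sum_mxtens /= mulr1n; apply: eq_bigr => p _.
by rewrite mxE; apply: eq_bigr => q _; rewrite ![in RHS]mxE ![_^T _ _]mxE !capE.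
Qed.

Lemma cupcap_sq W : cupcap W *m cupcap W = \tr (W *m W^T) *: cupcap W.
Proof.
rewrite /cupcap mulmxA -[_^T *m _ *m _]mulmxA cap_cup mul_mx_scalar.
by rewrite -scalemxAl.
Qed.

Lemma ptrace2_cupcap W : ptrace2 (cupcap W) = W *m W^T.
Proof.
apply/matrixP => i j; rewrite !mxE; apply: eq_bigr => l _.
by rewrite cupcapE mxE.
Qed.

Lemma cap_tens W (M N : 'M[A]_d) : cap W *m (M *t N) = cap (M^T *m W *m N).
Proof.
apply/matrixP => i j; rewrite ord1 {i}; case: (mxtens_indexP j) => p q.
rewrite mxE sum_mxtens capE mxE exchange_big; apply: eq_bigr => r _ /=.
rewrite mxE mulr_suml; apply: eq_bigr => t _.
by rewrite capE tensmxE mxE; ring.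
Qed.

Definition index3 (i j l : 'I_d) : 'I_(d * d * d) := mxtens_index (mxtens_index (i, j), l).

Lemma index3P x : exists i j l, x = index3 i j l.
Proof.
case: (mxtens_indexP x) => y l; case: (mxtens_indexP y) => i j.
by exists i, j, l.
Qed.

(** The maps cap (x) 1 and 1 (x) cap from V (x) V (x) V to V.  They are given by
    entries, which spares the casts from d * 1 and 1 * d to d. *)
Definition capl W : 'M[A]_(d, d * d * d) :=
  \matrix_(i, x) (W (mxtens_unindex (mxtens_unindex x).1).1
    (mxtens_unindex (mxtens_unindex x).1).2 * (i == (mxtens_unindex x).2)%:R).
Definition capr W : 'M[A]_(d, d * d * d) :=
  \matrix_(i, x) ((i == (mxtens_unindex (mxtens_unindex x).1).1)%:R *
    W (mxtens_unindex (mxtens_unindex x).1).2 (mxtens_unindex x).2).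

Lemma caplE W x i j l : capl W x (index3 i j l) = W i j * (x == l)%:R.
Proof. by rewrite mxE !mxtens_indexK. Qed.

Lemma caprE W x i j l : capr W x (index3 i j l) = (x == i)%:R * W j l.
Proof. by rewrite mxE !mxtens_indexK. Qed.

Lemma R12_cupcap W : R12 (cupcap W) = (capl W)^T *m capl W.
Proof.
apply/matrixP => x y; have [i [j [l ->]]] := index3P x; have [p [q [r ->]]] := index3P y.
rewrite tensmxE cupcapE !mxE.
under eq_bigr do rewrite mxE !caplE mulrAC mulrC mulrA.
by rewrite -(eq_bigr _ (fun i _ => mulrA _ _ _)) sum_deltal; ring.
Qed.

Lemma R23_cupcap W : R23 (cupcap W) = (capr W)^T *m capr W.
Proof.
apply/matrixP => x y; have [i [j [l ->]]] := index3P x; have [p [q [r ->]]] := index3P y.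
have E (a b c : 'I_d) : cast_ord (esym (mulnA d d d)) (index3 a b c) =
    mxtens_index (a, mxtens_index (b, c)).
  by apply: val_inj; rewrite /= mulnDl mulnA addnA.
rewrite castmxE !E tensmxE cupcapE !mxE.
under eq_bigr do rewrite mxE !caprE -mulrA.
by rewrite sum_deltal; ring.
Qed.

(** Straightening a cup followed by a cap on the other side: the two copies of
    the form share one tensor factor, over which they are multiplied. *)
Lemma zigzag W : capl W *m (capr W)^T = (W *m W)^T.
Proof.
apply/matrixP => i j; rewrite [LHS]mxE 2!sum_mxtens.
transitivity (\sum_p (p == j)%:R * \sum_q W p q * W q i); last first.
  by rewrite sum_deltal !mxE.
apply: eq_bigr => p _; rewrite mulr_sumr; apply: eq_bigr => q _.
rewrite -(sum_deltal i (fun l => (p == j)%:R * (W p q * W q l))).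
apply: eq_bigr => l _; rewrite -/(index3 p q l) [_^T _ _]mxE caplE caprE.
by rewrite [i == l]eq_sym [j == p]eq_sym; ring.
Qed.

(** In U1 U2 U1 the middle part is a zigzag followed by the mirror zigzag, that
    is the scalar c twice. *)
Lemma cupcap_tl W c : W *m W = c%:M ->
  R12 (cupcap W) *m R23 (cupcap W) *m R12 (cupcap W) = (c ^+ 2) *: R12 (cupcap W) /\
  R23 (cupcap W) *m R12 (cupcap W) *m R23 (cupcap W) = (c ^+ 2) *: R23 (cupcap W).
Proof.
move=> WW; have zz := zigzag W; rewrite WW tr_scalar_mx in zz.
have zz' : capr W *m (capl W)^T = c%:M by rewrite -[LHS]trmxK trmx_mul trmxK zz tr_scalar_mx.
rewrite R12_cupcap R23_cupcap; split.
  rewrite -[X in X *m _]mulmxA [X in _ *m X *m _]mulmxA zz -!mulmxA.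
  rewrite [X in _ *m (_ *m X)]mulmxA zz' !mul_scalar_mx -!scalemxAr scalerA.
  by rewrite expr2.
rewrite -[X in X *m _]mulmxA [X in _ *m X *m _]mulmxA zz' -!mulmxA.
rewrite [X in _ *m (_ *m X)]mulmxA zz !mul_scalar_mx -!scalemxAr scalerA.
by rewrite expr2.
Qed.

Lemma R12B (M N : 'M[A]_(d * d)) : R12 (M - N) = R12 M - R12 N.
Proof. by apply/matrixP => i j; rewrite !mxE mulrBl. Qed.

Lemma R12_1 : R12 (1%:M : 'M[A]_(d * d)) = 1%:M.
Proof. exact: tens1mx1. Qed.

Lemma R23B (M N : 'M[A]_(d * d)) : R23 (M - N) = R23 M - R23 N.
Proof. by apply/matrixP => i j; rewrite mxE [in RHS]mxE !castmxE !mxE mulrBr. Qed.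

Lemma R23_1 : R23 (1%:M : 'M[A]_(d * d)) = 1%:M.
Proof. by apply: Sq_inj; rewrite Sq_castmx tens1mx1 mulnA. Qed.

Lemma R12M (M N : 'M[A]_(d * d)) : R12 M *m R12 N = R12 (M *m N).
Proof. by rewrite /R12 tensmx_mul mulmx1. Qed.

Lemma R23M (M N : 'M[A]_(d * d)) : R23 M *m R23 N = R23 (M *m N).
Proof. by apply: Sq_inj; rewrite -scompE !Sq_castmx scompE tensmx_mul mulmx1. Qed.

Lemma R12Z c (M : 'M[A]_(d * d)) : R12 (c *: M) = c *: R12 M.
Proof. by apply/matrixP => i j; rewrite !mxE mulrA. Qed.

Lemma R23Z c (M : 'M[A]_(d * d)) : R23 (c *: M) = c *: R23 M.
Proof. by apply/matrixP => i j; rewrite mxE !castmxE !mxE mulrCA. Qed.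

(** In the expansion of (1 - U1)(1 - U2)(1 - U1) the coefficient of U1 is
    - 2 + loop - c^2.  It has to be - 1, the coefficient of U2, and this makes
    both sides of the Yang-Baxter equation 1 - U1 - U2 + U1 U2 + U2 U1. *)
Lemma pre_YBO_cupcap W c : W *m W = c%:M -> \tr (W *m W^T) = 1 + c ^+ 2 ->
  pre_YBO (1%:M - cupcap W).
Proof.
move=> /cupcap_tl [tl12 tl23] loop.
have sq12 : R12 (cupcap W) *m R12 (cupcap W) = (1 + c ^+ 2) *: R12 (cupcap W).
  by rewrite R12M cupcap_sq loop R12Z.
have sq23 : R23 (cupcap W) *m R23 (cupcap W) = (1 + c ^+ 2) *: R23 (cupcap W).
  by rewrite R23M cupcap_sq loop R23Z.
rewrite /pre_YBO R12B R23B R12_1 R23_1.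
move: (R12 _) (R23 _) tl12 tl23 sq12 sq23 => P Q PQP QPQ PP QQ.
have E (X Y : 'M[A]_(d * d * d)) : X *m Y *m X = c ^+ 2 *: X -> X *m X = (1 + c ^+ 2) *: X ->
    (1%:M - X) *m (1%:M - Y) *m (1%:M - X) = 1%:M - X - Y + X *m Y + Y *m X.
  move=> XYX XX; rewrite !mulmxBl !mul1mx !mulmxBr !mulmx1 !mulmxBl mul1mx XYX XX.
  rewrite scalerDl scale1r addrK; move: 1%:M (X *m Y) (Y *m X) => I S T.
  by apply/matrixP => i j; rewrite !mxE; ring.
rewrite !E // -!addrA; congr (_ + _); rewrite addrCA; congr (_ + (_ + _)).
exact: addrC.
Qed.

End CapCup.

(** * The R-matrix of the Jones polynomial *)
Section Antidiag.
Variable A : comNzRingType.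

Definition antidiag (a b : A) : 'M[A]_2 :=
  \matrix_(i, j) if i == 0 then (if j == 0 then 0 else a) else (if j == 0 then - b else 0).
Definition diag2 (a b : A) : 'M[A]_2 :=
  \matrix_(i, j) if i == j then (if i == 0 then a else b) else 0.
(** On the basis e1 e1, e1 e2, e2 e1, e2 e2 this is the six-vertex matrix that
    fixes e1 e1 and e2 e2 and has the middle block with rows (1 - a^2, a b) and
    (a b, 1 - b^2). *)
Definition jonesR a b := 1%:M - cupcap (antidiag a b).

Lemma mx2P (M N : 'M[A]_2) : M 0 0 = N 0 0 -> M 0 1 = N 0 1 -> M 1 0 = N 1 0 ->
  M 1 1 = N 1 1 -> M = N.
Proof.
move=> e00 e01 e10 e11; apply/matrixP => i j.
have two (l : 'I_2) : l = 0 \/ l = 1.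
  by case: l => [[|[|//]] h]; [left | right]; apply: val_inj.
by case: (two i) => ->; case: (two j) => ->.
Qed.

Lemma antidiag_sq a b : antidiag a b *m antidiag a b = (- (a * b))%:M.
Proof.
by apply: mx2P; rewrite !mxE !big_ord_recl big_ord0 !mxE /= ?mulr1n ?mulr0n; ring.
Qed.

Lemma antidiag_gram a b :
  antidiag a b *m (antidiag a b)^T = diag2 (a ^+ 2) (b ^+ 2).
Proof.
by apply: mx2P; rewrite !mxE !big_ord_recl !big_ord0 !mxE /=; ring.
Qed.

Lemma tr_diag2 a b : \tr (diag2 a b) = a + b.
Proof. by rewrite /mxtrace !big_ord_recl big_ord0 !mxE /= addr0. Qed.

Lemma pre_YBO_jonesR a b : a ^+ 2 + b ^+ 2 = 1 + (a * b) ^+ 2 -> pre_YBO (jonesR a b).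
Proof.
move=> ab; apply: (pre_YBO_cupcap (c := - (a * b))); first exact: antidiag_sq.
by rewrite antidiag_gram tr_diag2 sqrrN.
Qed.

(** The form is antidiagonal, so each of its terms meets the weights 1 and x
    once each. *)
Lemma cap_tens_diag2 a b x :
  cap (antidiag a b) *m (diag2 1 x *t diag2 1 x) = x *: cap (antidiag a b).
Proof.
rewrite cap_tens; have -> : (diag2 1 x)^T *m antidiag a b *m diag2 1 x = x *: antidiag a b.
  by apply: mx2P; rewrite !mxE !big_ord_recl big_ord0 !mxE !big_ord_recl !big_ord0 !mxE /=; ring.
by apply/matrixP => i j; rewrite !mxE.
Qed.

Lemma tr_diag2T a b : (diag2 a b)^T = diag2 a b.
Proof. by apply: mx2P; rewrite !mxE. Qed.

Lemma cupcap_tens_diag2 a b x (m := diag2 1 x) :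
  cupcap (antidiag a b) *m (m *t m) = x *: cupcap (antidiag a b) /\
  (m *t m) *m cupcap (antidiag a b) = x *: cupcap (antidiag a b).
Proof.
rewrite /cupcap; split; first by rewrite -mulmxA cap_tens_diag2 -scalemxAr.
rewrite mulmxA -{1}(trmxK (m *t m)) -trmx_mul trmx_tens tr_diag2T.
by rewrite cap_tens_diag2 linearZ /= -scalemxAl.
Qed.

Lemma jonesR_diag2C a b x (m := diag2 1 x) :
  (m *t m) *m jonesR a b = jonesR a b *m (m *t m).
Proof.
have [E E'] := cupcap_tens_diag2 a b x.
by rewrite /jonesR mulmxBl mulmxBr mul1mx mulmx1 E E'.
Qed.

Lemma ptrace2BZ d c (M N : 'M[A]_(d * d)) :
  ptrace2 (M - c *: N) = ptrace2 M - c *: ptrace2 N.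
Proof.
apply/matrixP => i j; rewrite !mxE mulr_sumr -sumrB; apply: eq_bigr => l _.
by rewrite !mxE.
Qed.

Lemma ptrace2_jonesR a b x (m := diag2 1 x) :
  ptrace2 (jonesR a b *m (m *t m)) = (1 + x) *: m - x *: diag2 (a ^+ 2) (b ^+ 2).
Proof.
have [E _] := cupcap_tens_diag2 a b x.
rewrite /jonesR mulmxBl mul1mx E -antidiag_gram -ptrace2_cupcap.
have -> : (1 + x) *: m = ptrace2 (m *t m).
  apply/matrixP => i j; rewrite [LHS]mxE [RHS]mxE; under eq_bigr do rewrite tensmxE.
  by rewrite -mulr_sumr mulrC -(tr_diag2 1 x).
exact: ptrace2BZ.
Qed.

Lemma cupcapZ d c (W : 'M[A]_d) : cupcap (c *: W) = c ^+ 2 *: cupcap W.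
Proof.
apply/matrixP => i j; case: (mxtens_indexP i) => p q; case: (mxtens_indexP j) => r t.
by rewrite [RHS]mxE !cupcapE !mxE; ring.
Qed.

Lemma cupcap_antidiagZ a b c :
  cupcap (antidiag (c * a) (c * b)) = c ^+ 2 *: cupcap (antidiag a b).
Proof.
have -> : antidiag (c * a) (c * b) = c *: antidiag a b.
  by apply: mx2P; rewrite !mxE /=; ring.
exact: cupcapZ.
Qed.

(** (1 - U)(1 - c^2 U) = 1 when c^2 is chosen so that U^2 absorbs the linear
    terms. *)
Lemma jonesR_mul a b c : c ^+ 2 * (a ^+ 2 + b ^+ 2) = 1 + c ^+ 2 ->
  jonesR a b *m jonesR (c * a) (c * b) = 1%:M /\
  jonesR (c * a) (c * b) *m jonesR a b = 1%:M.
Proof.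
move=> abc; rewrite /jonesR cupcap_antidiagZ; set U := cupcap _.
have UU : U *m U = (a ^+ 2 + b ^+ 2) *: U.
  by rewrite cupcap_sq antidiag_gram tr_diag2.
have Uc : U *m (c ^+ 2 *: U) = U + c ^+ 2 *: U /\ (c ^+ 2 *: U) *m U = U + c ^+ 2 *: U.
  by rewrite -scalemxAr -scalemxAl UU scalerA abc scalerDl scale1r.
have inv (X Y : 'M[A]_(2 * 2)) : X *m Y = X + Y -> (1%:M - X) *m (1%:M - Y) = 1%:M.
  by move=> XY; rewrite mulmxBl mul1mx mulmxBr mulmx1 XY opprB [X + Y]addrC addrK subrK.
by split; apply: inv; rewrite ?Uc.1 // Uc.2 addrC.
Qed.
End Antidiag.

(** For mu = diag(1, y) the partial trace of R (mu (x) mu) is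
    (1 + y) mu - y diag(1, x^2), which is mu for y = x^2. *)
Section Enhanced.
Variables (A : comUnitRingType) (x : A).
Hypothesis x_unit : x \is a GRing.unit.
Let m := diag2 1 (x ^+ 2).
Let R := jonesR 1 x.
Let R' := jonesR x^-1 1.

Lemma jonesR_inv : R *m R' = 1%:M /\ R' *m R = 1%:M.
Proof.
have := @jonesR_mul A 1 x x^-1; rewrite mulr1 mulVr //; apply.
by rewrite expr1n mulrDr mulr1 -exprMn mulVr // expr1n addrC.
Qed.

Lemma jonesR_YBO : pre_YBO R /\ pre_YBO R'.
Proof. by split; apply: pre_YBO_jonesR; ring. Qed.

Lemma jonesR_ptrace : ptrace2 (R *m (m *t m)) = m /\ ptrace2 (R' *m (m *t m)) = x ^+ 2 *: m.
Proof.
rewrite !ptrace2_jonesR expr1n; split.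
  by apply: mx2P; rewrite !mxE /=; ring.
have xx : x ^+ 2 * x^-1 ^+ 2 = 1 by rewrite -exprMn divrr // expr1n.
by apply: mx2P; rewrite !mxE /= ?xx; ring.
Qed.

Lemma jonesR_enhanced :
  enhanced_YBO R x^-1 x m /\ enhanced_YBO R' x^-1^-1 x m.
Proof.
have [RR' R'R] := jonesR_inv; have [ybe ybe'] := jonesR_YBO.
have [tR tR'] := jonesR_ptrace.
have [uR _] := mulmx1_unit RR'; have [uR' _] := mulmx1_unit R'R.
have iR : invmx R = R' by rewrite -[LHS]mulmx1 -RR' mulKmx.
have iR' : invmx R' = R by rewrite -[LHS]mulmx1 -R'R mulKmx.
(* In both cases the scalars are alpha beta = 1 for R and alpha^-1 beta = x^2 for R'. *)
split; split; rewrite ?iR ?iR' ?invrK ?unitrV //; try exact: jonesR_diag2C.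
by rewrite tR mulVr // scale1r.
by rewrite tR mulVr // scale1r.
Qed.

Lemma jonesR_skein : x^-1 *: R + (- x) *: R' = (x^-1 - x)%:M.
Proof.
have -> : R' = 1%:M - x^-1 ^+ 2 *: cupcap (antidiag 1 x).
  by rewrite -cupcap_antidiagZ mulr1 mulVr.
have xx : - x * x^-1 ^+ 2 = - x^-1 by rewrite expr2 mulrA mulNr divrr // mulN1r.
by rewrite !scalerBr !scalemx1 scalerA xx scaleNr opprK addrACA addNr addr0 -raddfD.
Qed.
End Enhanced.

(** * The Laurent deformation *)
Section Coefficients.
Variable k : comNzRingType.

(** The coefficients of 1 - (p + x q)^T (p + x q) as a polynomial in x. *)
Definition quad r (p q : 'rV[k]_r) (i : nat) : 'M[k]_r :=
  nth 0 [:: 1%:M - p^T *m p; - (p^T *m q + q^T *m p); - (q^T *m q)] i.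

Definition R_coef : nat -> 'M[k]_(2 * 2) :=
  quad (cap (antidiag 1 0)) (cap (antidiag 0 1)).
Definition Rinv_coef : nat -> 'M[k]_(2 * 2) :=
  quad (cap (antidiag 0 1)) (cap (antidiag 1 0)).
Definition mu_series_coef (i : nat) : 'M[k]_2 := nth 0 [:: diag2 1 0; 0; diag2 0 1] i.

Variables (A : comNzRingType) (f : {rmorphism k -> A}) (x : A).
(** The common form of the series over the truncated polynomial rings and over
    the Laurent polynomials: a value x in a k-algebra. *)
Definition series r n (c : nat -> 'M[k]_r) : 'M[A]_r :=
  \sum_(i < n.+1) x ^+ i *: map_mx f (c i).

(** Modulo x^(n+1) the truncation at order n is the whole polynomial, so that
    the Yang-Baxter equation is inherited by the truncations. *)
Lemma series_trunc r n (c : nat -> 'M[k]_r) : (n <= 2)%N -> x ^+ n.+1 = 0 ->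
  series n c = series 2 c.
Proof.
rewrite /series; case: n => [|[|[|//]]] // _; rewrite ?expr1 => xn.
  by rewrite !big_ord_recl !big_ord0 /= expr1 expr2 xn mul0r !scale0r !addr0.
by rewrite !big_ord_recl !big_ord0 /= xn !scale0r !addr0.
Qed.

Lemma series_quad r (p q : 'rV[k]_r) (w := map_mx f p + x *: map_mx f q) :
  series 2 (quad p q) = 1%:M - w^T *m w.
Proof.
rewrite /series !big_ord_recl big_ord0 /= addr0 expr0 expr1 scale1r /w.
rewrite map_mxB map_mx1 map_mxM !map_mxN map_mxD !map_mxM -!map_trmx.
move: (map_mx f p) (map_mx f q) => {w p q} p q.
apply/matrixP => i j; rewrite !mxE !big_ord1 !mxE; ring.
Qed.

Lemma map_cap_antidiag a b : map_mx f (cap (antidiag a b)) = cap (antidiag (f a) (f b)).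
Proof.
apply/matrixP => i j; case: (mxtens_indexP j) => p q.
rewrite ord1 mxE !capE !mxE; case: ifP => _; case: ifP => _ //; exact: rmorph0 || exact: rmorphN.
Qed.

Lemma cap_antidiagD (a b c e : A) : cap (antidiag a b) + x *: cap (antidiag c e) =
  cap (antidiag (a + x * c) (b + x * e)).
Proof.
apply/matrixP => i j; rewrite ![in LHS]mxE [RHS]mxE [RHS]mxE.
by case: ifP => _; case: ifP => _; ring.
Qed.

Lemma series_R : series 2 R_coef = jonesR 1 x.
Proof.
rewrite series_quad !map_cap_antidiag cap_antidiagD rmorph0 rmorph1 mulr0 mulr1 addr0 add0r.
by [].
Qed.

Lemma series_Rinv : series 2 Rinv_coef = jonesR x 1.
Proof.
rewrite series_quad !map_cap_antidiag cap_antidiagD rmorph0 rmorph1 mulr0 mulr1 addr0 add0r.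
by [].
Qed.

Lemma series_mu : series 2 mu_series_coef = diag2 1 (x ^+ 2).
Proof.
rewrite /series !big_ord_recl big_ord0 /= map_mx0 scaler0 addr0 add0r expr0 scale1r.
by apply: mx2P; rewrite !mxE /= ?rmorph0 ?rmorph1; ring.
Qed.

End Coefficients.

Section Truncation.
Variable k : comNzRingType.

Lemma in_qpolyXn_eq0 n : in_qpoly ('X^(n.+1) : {poly k}) 'X ^+ n.+1 = 0.
Proof.
rewrite -rmorphXn; apply/val_inj; rewrite /= /mk_monic size_polyXn monicXn /=.
exact: Pdiv.RingMonic.rmodpp (monicXn _ _).
Qed.

Lemma trunc_seriesE r n (c : nat -> 'M[k]_r) :
  trunc_series n c = series (in_qpoly ('X^(n.+1) : {poly k}) \o polyC)
    (in_qpoly ('X^(n.+1) : {poly k}) 'X) n c.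
Proof.
rewrite /trunc_series /poly_series /series raddf_sum; apply: eq_bigr => i _ /=.
by rewrite map_mxZ rmorphXn -map_mx_comp.
Qed.

Lemma pre_YBO_trunc n : (n <= 2)%N ->
  pre_YBO (trunc_series n (R_coef k)) /\ pre_YBO (trunc_series n (Rinv_coef k)).
Proof.
move=> n2; rewrite !trunc_seriesE !(series_trunc _ _ n2 (in_qpolyXn_eq0 n)).
by rewrite series_R series_Rinv; split; apply: pre_YBO_jonesR; ring.
Qed.

End Truncation.

Section LaurentRing.
Local Open Scope quotient_scope.
Variable k : comNzRingType.

(** Localization preserves non-zero-divisors.  This replaces cancellation in a
    domain, since k may have zero divisors. *)
Lemma embed_lreg (p : {poly k}) : GRing.lreg p -> GRing.lreg (Laurent.embed p).
Proof.
move=> p_reg; apply: mulrI0_lreg; elim/quotW => -[q n].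
have E0 l : \pi_(laurent k) ((0 : {poly k}), l) = 0.
  apply/eqP; rewrite -[X in _ == X]/(Laurent.embed (0 : {poly k})) piE.
  by rewrite /Laurent.equivl /= !mul0r.
rewrite {1}/Laurent.embed; unlock; rewrite -[X in X = _]Laurent.pi_mul -(E0 0%N).
move=> /eqmodP; rewrite /= /Laurent.equivl /= mulr1 mul0r => /eqP pq0.
suff -> : q = 0 by exact: etrans (E0 n) (esym (E0 0%N)).
by apply: p_reg; rewrite pq0 mulr0.
Qed.

End LaurentRing.

Section JonesLEYBO.
Variable k : comNzRingType.
Local Notation h := (hbar k).

(** Clearing the denominator hbar, the regularity of an element is read off a
    monic polynomial. *)
Lemma regular_of_monic (p : {poly k}) (a : laurent k) :
  p \is monic -> h * a = Laurent.embed p -> GRing.lreg a.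
Proof.
by move=> /monic_lreg/embed_lreg reg ha; apply: GRing.lregMl (_ : GRing.lreg (h * a)); rewrite ha.
Qed.

Lemma hbarD_reg : GRing.lreg (h + h^-1).
Proof.
apply: (@regular_of_monic ('X^2 + 1)).
  by rewrite monicE lead_coefDl ?lead_coefXn // size_polyXn size_poly1.
rewrite mulrDr divrr ?hbar_unit // rmorphD rmorph1 rmorphXn expr2 //.
Qed.

Lemma hbarB_reg : GRing.lreg (h^-1 - h).
Proof.
rewrite -opprB; apply: GRing.lregN; apply: (@regular_of_monic ('X^2 - 1)).
  by rewrite monicE lead_coefDl ?lead_coefXn // size_polyXn size_polyN size_poly1.
by rewrite mulrBr divrr ?hbar_unit // rmorphB rmorph1 rmorphXn expr2.
Qed.

Definition lconst_morphism : {rmorphism k -> laurent k} := (@Laurent.embed k \o polyC).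

Lemma laurent_seriesE r x (c : nat -> 'M[k]_r) n :
  laurent_series x n c = series lconst_morphism x n c.
Proof. by []. Qed.

Lemma jones_deformation : laurent_deformation 2 (R_coef k) (Rinv_coef k).
Proof.
rewrite /laurent_deformation /= !laurent_seriesE series_R series_Rinv.
have [ybe ybe'] := jonesR_YBO h.
split; [| | exact: ybe | exact: ybe' | exact: jonesR_inv (hbar_unit k)].
  by move=> n n2; have [? _] := pre_YBO_trunc k n2.
by move=> n n2; have [_ ?] := pre_YBO_trunc k n2.
Qed.

Lemma jones_enhanced : enhanced_YBO (laurent_series h 2 (R_coef k)) h^-1 h
  (laurent_series h 2 (mu_series_coef k)).
Proof.
rewrite !laurent_seriesE series_R series_mu; exact: (jonesR_enhanced (hbar_unit k)).1.
Qed.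

Lemma jones_enhanced_inv : enhanced_YBO (laurent_series h^-1 2 (Rinv_coef k)) h^-1^-1 h
  (laurent_series h 2 (mu_series_coef k)).
Proof.
rewrite !laurent_seriesE series_Rinv series_mu; exact: (jonesR_enhanced (hbar_unit k)).2.
Qed.

Definition jones_LEYBO : LEYBO k :=
  MkLEYBO jones_deformation jones_enhanced jones_enhanced_inv.

End JonesLEYBO.

(** * The quantum invariant of a LEYBO *)

Section QuantumInvariant.
Variables (k : comNzRingType) (L : LEYBO k).

Definition Rsign (s : bool) := if s then Rtilde L else Rtilde_inv L.

Lemma braid_repE n (b : braid n) : braid_rep L b = braid_op Rsign b.
Proof.
apply: eq_bigr => x _; congr castmx; congr (_, _); exact: nat_irrelevance.
Qed.

Lemma state_traceE n (b : braid n) : state_trace L b = braid_trace Rsign (mu L) b.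
Proof. by rewrite /state_trace braid_repE. Qed.

Lemma quantum_invariantE n (b : braid n) :
  quantum_invariant L b = normalized_trace Rsign (mu L) (alpha L) (beta L) b.
Proof. by rewrite /quantum_invariant state_traceE. Qed.

Lemma quantum_invariant_same_link m n (b : braid m) (c : braid n) :
  same_link b c -> quantum_invariant L b = quantum_invariant L c.
Proof.
rewrite !quantum_invariantE.
have [[ybe _] [ua ub] Cp tp _] := enhancedP L; have [_ _ Cn tn _] := enhanced_invP L.
have [_ _ _ _ [RV VR]] := deformationP L.
by apply: normalized_trace_same_link => //; case.
Qed.

Lemma quantum_invariant_skein n (u v : braid n) i a b c :
  a *: Rtilde L + b *: Rtilde_inv L = c%:M ->
  a * alpha L * quantum_invariant L (u ++ (i, true) :: v) +
  b * (alpha L)^-1 * quantum_invariant L (u ++ (i, false) :: v) =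
  c * quantum_invariant L (u ++ v).
Proof.
rewrite !quantum_invariantE; have [_ [ua _] _ _ _] := enhancedP L.
by move=> E; apply: normalized_trace_skein.
Qed.
End QuantumInvariant.

(** * Reduction of words in the Hecke algebra *)
Section HeckeWords.
Local Open Scope nat_scope.

(** P stands for a property of positive braid words that is stable under linear
    combinations, for instance that a given family of traces is determined at
    the word.  The quadratic relation of the Hecke algebra appears in the form
    [Pquad]; no formal linear combinations are needed. *)
Variables (n : nat) (P : seq nat -> Prop).
Hypothesis Pquad : forall u v i, P (u ++ v) -> P (u ++ i :: v) -> P (u ++ i :: i :: v).
Hypothesis Pfar : forall u v i j, i.+1 < j ->
  P (u ++ i :: j :: v) <-> P (u ++ j :: i :: v).
Hypothesis Pbraid : forall u v i, i.+1 < n ->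
  P (u ++ i :: i.+1 :: i :: v) -> P (u ++ i.+1 :: i :: i.+1 :: v).

Lemma slide_top u v x l : all (fun i => i.+1 < l) x ->
  P (u ++ x ++ l :: v) <-> P (u ++ l :: x ++ v).
Proof.
elim/last_ind: x v => [|x i IHx] v //; rewrite all_rcons => /andP [il xl].
rewrite !cat_rcons -(IHx (i :: v)) // !catA.
exact: Pfar.
Qed.

Lemma split_first (l : nat) w : l \in w -> exists x v, w = x ++ l :: v /\ l \notin x.
Proof.
elim: w => [//|i w IHw]; rewrite inE; case: eqVneq => [<- _|neq /= lw].
  by exists [::], w.
have [x [v [-> lx]]] := IHw lw; exists (i :: x), v.
by rewrite inE negb_or neq.
Qed.

Lemma notin_top l w : all (leq^~ l) w -> l \notin w -> all (ltn^~ l) w.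
Proof.
move=> /allP wl lw; apply/allP => i iw; rewrite /= ltn_neqAle wl // andbT.
by apply: contraNneq lw => <-.
Qed.

(** The decomposition H_(l+1) = H_l + H_l s_l H_l of Hecke algebras.  Between the
    first two occurrences of the top letter there is a word in lower letters,
    and by induction on l it contains the next letter at most once.  If it does
    not contain it, the two top letters can be brought together and the
    quadratic relation applies; if it contains it once, the braid relation
    exchanges two top letters for one. *)
Lemma top_at_most_once l w u v : l < n -> all (leq^~ l) w ->
  (forall x, all (leq^~ l) x -> count_mem l x <= 1 -> P (u ++ x ++ v)) ->
  P (u ++ w ++ v).
Proof.
elim: l w u v => [|l IHl] w u v ln.
  move=> w0 Pbase.
  have {w0} -> : w = nseq (size w) 0.
    by apply/all_pred1P; apply: sub_all w0 => i; rewrite leqn0.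
  (* Words in one letter: only the quadratic relation is available. *)
  elim/ltn_ind: (size w) => -[|[|k]] IHk; try by apply: Pbase; rewrite //= ?leqnn.
  by apply: Pquad; [apply: (IHk k) | apply: (IHk k.+1)].
have [k] := ubnP (count_mem l.+1 w); elim: k w u v => // k IHk w u v wk wl Pbase.
have [w1|w2] := leqP (count_mem l.+1 w) 1; first exact: Pbase.
have [a [w' [Ew la]]] : exists a w', w = a ++ l.+1 :: w' /\ l.+1 \notin a.
  by apply: split_first; rewrite -has_pred1 has_count //; apply: ltnW.
have Ca : count_mem l.+1 a = 0 by apply/count_memPn.
rewrite {}Ew count_cat /= eqxx Ca add0n add1n in wk w2 wl *.
have [x [b [Ew lx]]] : exists x b, w' = x ++ l.+1 :: b /\ l.+1 \notin x.
  by apply: split_first; rewrite -has_pred1 has_count.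
have Cx : count_mem l.+1 x = 0 by apply/count_memPn.
rewrite {}Ew count_cat /= eqxx Cx add0n add1n in wk w2 wl *.
move: wl; rewrite all_cat /= all_cat /= => /and5P [al _ xl _ bl].
have {xl lx} xl : all (leq^~ l) x by apply: sub_all (notin_top xl lx) => i.
(* The induction hypothesis on the number of top letters. *)
have shorter y : all (leq^~ l.+1) y -> count_mem l.+1 y <= 1 ->
    P (u ++ (a ++ y ++ b) ++ v).
  move=> yl y1; apply: IHk => //; last by rewrite !all_cat al yl.
  by rewrite !count_cat Ca add0n -ltnS (leq_trans _ wk) // !ltnS -[leqRHS]add1n leq_add2r.
have -> : u ++ (a ++ l.+1 :: x ++ l.+1 :: b) ++ v =
    (u ++ a ++ [:: l.+1]) ++ x ++ l.+1 :: b ++ v.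
  by rewrite -?catA /= -?catA.
apply: IHl => //; first exact: ltnW.
have low : subpred (ltn^~ l) (leq^~ l.+1) by move=> i /ltnW /leqW.
(* From here on the middle word s has at most one letter l. *)
move=> s sl s1; have [ls|ls] := boolP (l \in s); last first.
  have {sl} sl := notin_top sl ls.
  rewrite -!catA /=; rewrite catA -slide_top -?catA; last first.
    by apply: sub_all sl => i.
  have sl' := sub_all low sl.
  have sC : count_mem l.+1 s = 0.
    by apply/count_memPn; apply/negP => /(allP sl); rewrite /= ltnNge leqnSn.
  rewrite !catA; apply: Pquad.
    by have := shorter s sl'; rewrite sC -!catA; apply.
  have := shorter (s ++ [:: l.+1]).
  by rewrite all_cat sl' /= leqnn count_cat sC /= eqxx -!catA; apply.
have [y [z [Es ly]]] := split_first ls.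
have Cy : count_mem l y = 0 by apply/count_memPn.
have lz : l \notin z.
  by apply/count_memPn; move: s1; rewrite Es count_cat /= eqxx Cy; lia.
move: sl; rewrite Es all_cat /= leqnn /= => /andP [yl zl].
have {yl ly} yl := notin_top yl ly; have {zl lz} zl := notin_top zl lz.
have yl' := sub_all low yl.
have zl' := sub_all low zl.
have yC : count_mem l.+1 y = 0.
  by apply/count_memPn; apply/negP => /(allP yl); rewrite /= ltnNge leqnSn.
have zC : count_mem l.+1 z = 0.
  by apply/count_memPn; apply/negP => /(allP zl); rewrite /= ltnNge leqnSn.
have -> : (u ++ a ++ [:: l.+1]) ++ (y ++ l :: z) ++ l.+1 :: b ++ v =
    (u ++ a) ++ l.+1 :: y ++ l :: z ++ l.+1 :: b ++ v by rewrite -?catA /= -?catA.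
rewrite -slide_top; last by apply: sub_all yl => i.
have -> : (u ++ a) ++ y ++ l.+1 :: l :: z ++ l.+1 :: b ++ v =
    ((u ++ a) ++ y ++ [:: l.+1; l]) ++ z ++ l.+1 :: b ++ v by rewrite -!catA.
rewrite slide_top; last by apply: sub_all zl => i.
have -> : ((u ++ a) ++ y ++ [:: l.+1; l]) ++ l.+1 :: z ++ b ++ v =
    (u ++ a ++ y) ++ l.+1 :: l :: l.+1 :: z ++ b ++ v by rewrite -!catA.
apply: Pbraid => //.
have := shorter (y ++ l :: l.+1 :: l :: z).
rewrite all_cat yl' /= zl' !leqnn leqnSn count_cat /= yC zC eqxx.
rewrite (ltn_eqF (ltnSn l)) /=.
by move=> /(_ isT isT); rewrite -?catA /= -?catA.
Qed.

End HeckeWords.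

(** * Skein invariants are determined by the value at the unknot *)
Section Skein.
Variables (A : comUnitRingType) (s : A).
Hypotheses (s_unit : s \is a GRing.unit) (z_reg : GRing.lreg (s^-1 - s)).
Implicit Type F : forall n, braid n -> A.

Definition skein_invariant F : Prop :=
  (forall m n (b : braid m) (c : braid n), same_link b c -> F m b = F n c) /\
  (forall n (u v : braid n) (i : 'I_n),
     s ^- 2 * F n (u ++ (i, true) :: v) - s ^+ 2 * F n (u ++ (i, false) :: v)
       = (s^-1 - s) * F n (u ++ v)).

Definition determined n (b : braid n) : Prop :=
  exists c, forall F, skein_invariant F -> F n b = c * F 0%N [::].

Lemma determined_same_link m n (b : braid m) (c : braid n) :
  same_link b c -> determined c -> determined b.
Proof. by move=> bc [x Ex]; exists x => F FI; rewrite -Ex // (FI.1 _ _ _ _ bc). Qed.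

Lemma determined_comb m n p (b : braid m) (c : braid n) (e : braid p) x y :
  (forall F, skein_invariant F -> F m b = x * F n c + y * F p e) ->
  determined c -> determined e -> determined b.
Proof.
move=> E [z Ez] [t Et]; exists (x * z + y * t) => F FI.
by rewrite E // Ez // Et // mulrDl !mulrA.
Qed.

(** The coefficients of the two crossings in the skein relation are invertible,
    so each crossing can be exchanged for the other one. *)
Lemma skein_switch e n (u v : braid n) i :
  determined (u ++ (i, ~~ e) :: v) -> determined (u ++ v) ->
  determined (u ++ (i, e) :: v).
Proof.
have s2 : s ^+ 2 \is a GRing.unit by rewrite unitrX.
case: e => /=.
  apply: (determined_comb (x := s ^+ 2 * s ^+ 2) (y := s ^+ 2 * (s^-1 - s))) => F [_ skein].
  rewrite -(mulrA _ _ (F _ (_ ++ (_, _) :: _))) -(mulrA _ _ (F _ (u ++ v))).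
  by rewrite -mulrDr -(skein _ u v i) addrC subrK mulVKr.
apply: (determined_comb (x := s ^- 2 * s ^- 2) (y := - (s ^- 2 * (s^-1 - s)))) => F [_ skein].
rewrite mulNr -(mulrA _ _ (F _ (_ ++ (_, _) :: _))) -(mulrA _ _ (F _ (u ++ v))).
by rewrite -mulrBr -(skein _ u v i) subKr mulKr.
Qed.

(** Both ways of joining an added string by one crossing give the original link.
    The skein relation at this crossing determines the value of the split link,
    because s^-2 - s^2 = (s^-1 - s)(s^-1 + s) and s^-1 - s can be cancelled. *)
Lemma skein_split F n (u : braid n) : skein_invariant F ->
  F n.+1 (add_string u) = (s^-1 + s) * F n u.
Proof.
move=> FI; apply: z_reg.
have [link skein] := FI.
have stab t : F n.+1 (add_string u ++ (ord_max, t) :: [::]) = F n u.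
  by apply/esym/link; rewrite cats1; apply: SL_stab.
rewrite -[X in _ * F _ X = _]cats0 -(skein _ _ _ ord_max) !stab -mulrBl mulrA; congr (_ * _).
by rewrite -exprVn; ring.
Qed.

Lemma determined_add_string n (u : braid n) :
  determined u -> determined (add_string u).
Proof.
by move=> [c Ec]; exists ((s^-1 + s) * c) => F FI; rewrite skein_split // Ec // mulrA.
Qed.

(** Positive words are written with natural numbers, so that a word keeps its
    form when a string is added; letters that are not generators are dropped. *)
Definition letter n (i : nat) : option ('I_n * bool) :=
  omap (fun j : 'I_n => (j, true)) (insub i).
Definition word n (w : seq nat) : braid n := pmap (@letter n) w.

Lemma word_cat n u v : word n (u ++ v) = word n u ++ word n v.
Proof. exact: pmap_cat. Qed.

Lemma word_cons n i (lt_in : (i < n)%N) w :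
  word n (i :: w) = (Ordinal lt_in, true) :: word n w.
Proof. by rewrite /word /= /letter insubT. Qed.

Lemma word_cons_out n i w : (i < n)%N = false -> word n (i :: w) = word n w.
Proof. by move=> i_n; rewrite /word /= /letter insubF. Qed.

Lemma add_string_word n w : all (ltn^~ n) w -> add_string (word n w) = word n.+1 w.
Proof.
elim: w => [//|i w IHw] /andP [i_n wn].
rewrite (word_cons i_n) (word_cons (ltnW i_n : (i < n.+1)%N)) /= IHw //.
by congr (( _, _) :: _); apply: val_inj.
Qed.

Local Notation P n w := (determined (word n w)).

Lemma word_quad n u v i : P n (u ++ v) -> P n (u ++ i :: v) -> P n (u ++ i :: i :: v).
Proof.
rewrite !word_cat; case: (boolP (i < n)%N) => [i_n|/negbTE i_n]; last first.
  by rewrite !word_cons_out.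
rewrite !(word_cons i_n); move=> Puv Piv; apply: skein_switch => //=.
exact: determined_same_link (SL_cancel _ _ _ false) Puv.
Qed.

Lemma word_far n u v i j : (i.+1 < j)%N ->
  P n (u ++ i :: j :: v) <-> P n (u ++ j :: i :: v).
Proof.
move=> ij; rewrite !word_cat.
have cons1 l w : word n (l :: w) = word n [:: l] ++ word n w by rewrite -word_cat.
case: (boolP (i < n)%N) => [i_n|/negbTE i_n]; last first.
  by rewrite (cons1 j (i :: v)) !(word_cons_out _ i_n) -cons1.
case: (boolP (j < n)%N) => [j_n|/negbTE j_n]; last first.
  by rewrite (cons1 i (j :: v)) !(word_cons_out _ j_n) -cons1.
rewrite !(word_cons i_n, word_cons j_n).
have far := SL_far (word n u) (word n v) (ij : ((Ordinal i_n).+1 < Ordinal j_n)%N).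
by split; apply: determined_same_link => //; apply: SL_sym.
Qed.

Lemma word_braid n u v i : (i.+1 < n)%N ->
  P n (u ++ i :: i.+1 :: i :: v) -> P n (u ++ i.+1 :: i :: i.+1 :: v).
Proof.
move=> i1_n; have i_n := ltnW i1_n.
rewrite !word_cat !(word_cons i_n, word_cons i1_n); apply: determined_same_link.
exact/SL_sym/SL_braid.
Qed.

(** Induction on the number of strings, from a word that contains the last
    generator at most once. *)
Lemma positive_determined n w : all (ltn^~ n) w -> determined (word n w).
Proof.
elim: n w => [|n IHn] w wn.
  by case: w wn => // _; exists 1 => F _; rewrite mul1r.
have wl : all (leq^~ n) w by apply: sub_all wn => i.
have := @top_at_most_once n.+1 (fun w => P n.+1 w) (@word_quad _) (@word_far _) (@word_braid _)
  n w [::] [::] (ltnSn n) wl.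
rewrite cats0; apply => {wn wl w} w wl w1; rewrite cats0 /=.
have [nw|nw] := boolP (n \in w); last first.
  by rewrite -add_string_word ?notin_top //; apply/determined_add_string/IHn/notin_top.
have [x [y [Ew nx]]] := split_first nw.
have ny : n \notin y.
  by apply/count_memPn; move: w1; rewrite Ew count_cat /= eqxx (count_memPn nx); lia.
move: wl; rewrite Ew all_cat /= leqnn /= => /andP [xl yl].
have xn := notin_top xl nx; have yn := notin_top yl ny.
(* x n y is conjugate to y x n, the stabilization of y x. *)
rewrite word_cat (word_cons (ltnSn n)).
apply: determined_same_link (SL_conj _ _) _; rewrite -cat1s -catA.
apply: determined_same_link (SL_conj _ _) _.
rewrite -word_cat -add_string_word ?all_cat ?xn ?yn // cats1.
rewrite (_ : Ordinal _ = ord_max); last exact: val_inj.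
apply: determined_same_link (SL_sym (SL_stab _ _)) _.
by apply: IHn; rewrite all_cat yn.
Qed.

(** Negative crossings are replaced one after the other, at the cost of shorter
    words; w is the part of the word that is already positive. *)
Lemma skein_determined n (b : braid n) : determined b.
Proof.
suff det w : all (ltn^~ n) w -> determined (word n w ++ b) by apply: (det [::]).
elim: b w => [|[i e] b IHb] w wn; first by rewrite cats0; apply: positive_determined.
have Pi : determined (word n w ++ (i, true) :: b).
  have := IHb (rcons w i); rewrite all_rcons wn /= ltn_ord => /(_ isT).
  rewrite -cats1 word_cat (word_cons (ltn_ord i)) -catA /=.
  by rewrite (_ : Ordinal _ = i) //; apply: val_inj.
by case: e => //; apply: skein_switch => //; apply: IHb.
Qed.

End Skein.

(** * The Jones polynomial *)
Section JonesInvariant.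
Variable k : comNzRingType.
Local Notation h := (hbar k).
Local Notation L := (jones_LEYBO k).

Lemma jones_skein : h^-1 *: Rtilde L + (- h) *: Rtilde_inv L = (h^-1 - h)%:M.
Proof.
rewrite /Rtilde /Rtilde_inv !laurent_seriesE series_R series_Rinv.
exact: jonesR_skein (hbar_unit k).
Qed.

Lemma quantum_skein_invariant : skein_invariant h (fun n b => quantum_invariant L b).
Proof.
split=> [m n b c|n u v i]; first exact: quantum_invariant_same_link.
rewrite -(quantum_invariant_skein u v i jones_skein) -exprVn expr2.
by rewrite [alpha L]/(h^-1) invrK [- h * h]mulNr mulNr -expr2.
Qed.

Lemma quantum_unknot : quantum_invariant L ([::] : braid 0) = h + h^-1.
Proof.
rewrite quantum_invariantE /normalized_trace /braid_trace braid_op_nil mul1mx ntensmx1.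
rewrite /mu laurent_seriesE series_mu tr_diag2 /writhe /= subrr oppr0 expr0z mul1r.
rewrite exprN1 mulrDr mulr1 expr2 mulKr ?hbar_unit //; exact: addrC.
Qed.

Lemma quantum_invariant_hbar n (D : braid n) : quantum_invariant L D =
  h ^ ((npos D)%:Z - (nneg D)%:Z - n.+1%:Z) * state_trace L D.
Proof.
rewrite /quantum_invariant [alpha L]/(h^-1) [beta L]/h exprz_inv opprK.
by rewrite -exprzDr ?hbar_unit.
Qed.

End JonesInvariant.

Theorem theorem9p5 (k : comNzRingType) :
  exists L : LEYBO k,
    (exists J, jones_polynomial (hbar k) J) /\
    forall J : forall n : nat, braid n -> laurent k,
      jones_polynomial (hbar k) J ->
      forall (m : nat) (K : braid m) (n : nat) (D : braid n), same_link K D ->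
        (hbar k + (hbar k)^-1) * J m K = quantum_invariant L D /\
        (hbar k + (hbar k)^-1) * J m K =
          hbar k ^ ((npos D)%:Z - (nneg D)%:Z - n.+1%:Z) * state_trace L D.
Proof.
have QI := quantum_skein_invariant k.
have det n (b : braid n) := cid (skein_determined (hbar_unit k) (@hbarB_reg k) b).
exists (jones_LEYBO k); split.
  exists (fun n b => projT1 (det n b)).
  (* The axioms of a Jones polynomial are inherited from the quantum invariant by
     cancelling hbar + hbar^-1. *)
  have QJ n (b : braid n) : quantum_invariant (jones_LEYBO k) b =
      (hbar k + (hbar k)^-1) * projT1 (det n b).
    by rewrite (projT2 (det n b) _ QI) quantum_unknot mulrC.
  have [link skein] := QI.
  split=> [m n b c bc||n u v i]; apply: (@hbarD_reg k).
  - by rewrite -!QJ; apply: link.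
  - by rewrite -QJ quantum_unknot mulr1.
  - by rewrite mulrBr ![(hbar k + _) * (_ * projT1 _)]mulrCA -!QJ skein.
move=> J [link J1 skein] m K n D KD.
have -> : (hbar k + (hbar k)^-1) * J m K = quantum_invariant (jones_LEYBO k) D.
  rewrite (link _ _ _ _ KD); have Ec := projT2 (det n D).
  by rewrite (Ec _ QI) (Ec J (conj link skein)) J1 mulr1 quantum_unknot mulrC.
by split=> //; apply: quantum_invariant_hbar.
Qed.
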